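(* Let $n\ge1$ and let $\mathcal{BC}_n$ be the arrangement in $\mathbb{R}^n$ with hyperplanes $$x_i=-\tfrac32,-1,-\tfrac12,0,\tfrac12\ (1\le i\le n),\qquad x_i+x_j=-2,-1,0,\qquad x_i-x_j=-1,0,1\ (1\le i<j\le n).$$ Then the number of bounded regions of $\mathcal{BC}_n$ is $$2^n\,n!\binom{2n}{n}.$$
   Context: A region of an arrangement in $\mathbb{R}^n$ is a connected component of the complement of the union of its hyperplanes. A region is bounded if its intersection with the subspace spanned by the normal vectors to the hyperplanes is bounded. $\mathcal{BC}_n$ is the translate (by $X_i=x_i+\tfrac12$) of the type $BC$ Catalan arrangement $X_i=-1,0,1$; $2X_i=-1,0,1$; $X_i\pm X_j=-1,0,1$. *)

(* Defs.v *)
From HB Require Import structures.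
From mathcomp Require Import all_boot all_order all_algebra.
From mathcomp Require Import all_classical all_reals all_analysis.
Set Implicit Arguments.
Unset Strict Implicit.
Unset Printing Implicit Defensive.
Import Order.TTheory GRing.Theory Num.Theory.
Import numFieldNormedType.Exports.
Local Open Scope classical_set_scope.
Local Open Scope ring_scope.

(* The pair (a, b) stands for the hyperplane a_1 x_1 + ... + a_n x_n = b; the
   normal vector a is meant to be nonzero (see BC_normal_neq0 below). *)
Definition arrangement (R : realType) (n : nat) := seq ('rV[R]_n * R).

Definition hyperplane (R : realType) (n : nat) (h : 'rV[R]_n * R) :
    set 'rV[R]_n :=
  [set x | \sum_(i < n) h.1 0 i * x 0 i = h.2].

Definition arr_complement (R : realType) (n : nat) (A : arrangement R n) :
    set 'rV[R]_n :=
  ~` \bigcup_(h in [set` A]) hyperplane h.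

Definition regions (R : realType) (n : nat) (A : arrangement R n) :
    set (set 'rV[R]_n) :=
  [set connected_component (arr_complement A) x | x in arr_complement A].

Definition normal_span (R : realType) (n : nat) (A : arrangement R n) :
    {vspace 'rV[R]_n} :=
  <<[seq h.1 | h <- A]>>%VS.

Definition bounded_regions (R : realType) (n : nat) (A : arrangement R n) :
    set (set 'rV[R]_n) :=
  [set C | regions A C /\ bounded_set (C `&` [set` normal_span A])].

Definition evec (R : realType) (n : nat) (i : 'I_n) : 'rV[R]_n := delta_mx 0 i.
Arguments evec R {n} i.

Definition BC (R : realType) (n : nat) : arrangement R n :=
  let pairs := [seq ij : 'I_n * 'I_n <- enum {: 'I_n * 'I_n} | (ij.1 < ij.2)%N] in
     [seq (evec R i, c) | i <- enum 'I_n,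
        c <- [:: - (3 / 2); - 1; - (1 / 2); 0; 1 / 2]]
  ++ [seq (evec R ij.1 + evec R ij.2, c) | ij <- pairs, c <- [:: - 2; - 1; 0]]
  ++ [seq (evec R ij.1 - evec R ij.2, c) | ij <- pairs, c <- [:: - 1; 0; 1]].

Lemma BC_normal_neq0 (R : realType) (n : nat) (h : 'rV[R]_n * R) :
  h \in BC R n -> h.1 != 0.
Proof.
have nz (v : 'rV[R]_n) i : v 0 i = 1 -> v != 0.
  by move=> vi; apply/eqP => v0; move/eqP: vi; rewrite v0 mxE eq_sym oner_eq0.
rewrite !mem_cat => /or3P[] /allpairsP[[i c] /=].
- by move=> [_ _ ->]; apply: (@nz _ i); rewrite !mxE !eqxx.
- rewrite mem_filter => -[/andP[lt_ij _] _ ->]; apply: (@nz _ i.1).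
  by rewrite !mxE !eqxx /= -val_eqE /= (ltn_eqF lt_ij) addr0.
- rewrite mem_filter => -[/andP[lt_ij _] _ ->]; apply: (@nz _ i.1).
  by rewrite !mxE !eqxx /= -val_eqE /= (ltn_eqF lt_ij) subr0.
Qed.

(* The coordinate description of the union of the hyperplanes of BC. *)
Lemma BC_unionP (R : realType) (n : nat) (x : 'rV[R]_n) :
  (\bigcup_(h in [set` BC R n]) hyperplane h) x <->
  [\/ exists i, x 0 i \in [:: - (3 / 2); - 1; - (1 / 2); 0; 1 / 2],
      exists i j : 'I_n, (i < j)%N /\ x 0 i + x 0 j \in [:: - 2; - 1; 0]
    | exists i j : 'I_n, (i < j)%N /\ x 0 i - x 0 j \in [:: - 1; 0; 1]].
Proof.
have dotE i : \sum_(k < n) (evec R i) 0 k * x 0 k = x 0 i.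
  rewrite (bigD1 i)//= big1 => [|k ki].
    by rewrite mxE !eqxx mul1r addr0.
  by rewrite mxE (negbTE ki) andbF mul0r.
have dotD (i j : 'I_n) :
    \sum_(k < n) (evec R i + evec R j) 0 k * x 0 k = x 0 i + x 0 j.
  by rewrite -!dotE -big_split; apply: eq_bigr => k _; rewrite mxE mulrDl.
have dotB (i j : 'I_n) :
    \sum_(k < n) (evec R i - evec R j) 0 k * x 0 k = x 0 i - x 0 j.
  by rewrite -!dotE -sumrB; apply: eq_bigr => k _; rewrite !mxE mulrBl.
split=> [[h /= + hx]|].
  rewrite !mem_cat => /or3P[] /allpairsP[[i c] /= [+ ic hE]];
    move: hx; rewrite hE /hyperplane /=.
  - by move=> /(etrans (esym (dotE _))) xc _; apply: Or31; exists i; rewrite xc.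
  - by rewrite mem_filter => /(etrans (esym (dotD _ _))) xc /andP[? _]; apply: Or32;
      exists i.1, i.2; rewrite xc.
  - by rewrite mem_filter => /(etrans (esym (dotB _ _))) xc /andP[? _]; apply: Or33;
      exists i.1, i.2; rewrite xc.
case=> [[i xi]|[i [j [ij xij]]]|[i [j [ij xij]]]].
- exists (evec R i, x 0 i); last exact: dotE.
  by rewrite /= !mem_cat; apply/or3P/Or31/allpairsP; exists (i, x 0 i);
    split=> //=; rewrite mem_enum.
- exists (evec R i + evec R j, x 0 i + x 0 j); last exact: dotD.
  rewrite /= !mem_cat; apply/or3P/Or32/allpairsP.
  by exists ((i, j), x 0 i + x 0 j); split=> //=; rewrite mem_filter mem_enum ij.
- exists (evec R i - evec R j, x 0 i - x 0 j); last exact: dotB.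
  rewrite /= !mem_cat; apply/or3P/Or33/allpairsP.
  by exists ((i, j), x 0 i - x 0 j); split=> //=; rewrite mem_filter mem_enum ij.
Qed.

(* Main.v *)
Require Import Defs.
From HB Require Import structures.
From mathcomp Require Import all_boot all_order all_algebra.
From mathcomp Require Import all_classical all_reals all_analysis.
From mathcomp Require Import perm zify lra.
Set Implicit Arguments.
Unset Strict Implicit.
Unset Printing Implicit Defensive.
Import Order.TTheory GRing.Theory Num.Theory.
Import numFieldNormedType.Exports.
(* Put X_i = x_i + 1/2.  The signed permutations of the coordinates X preserve
   the arrangement, and a region lies in one chamber: it fixes the signs of the
   X_i and the order 0 = Y_0 < Y_1 < ... < Y_n of the |X_i|.  Inside the chamber
   the region is given by the comparisons of the 2 n + 1 symmetric points
   p_j = Y_j, p_(-j) = - Y_j with their translates p_l + 1, that is, by the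
   numbers v_i of l in [-i, i] with p_l + 1 < Y_i.  These satisfy
   v_i = 0 or v_i < v_(i+1), and any such v with v_i < 2 i comes from a region:
   Y_(i+1) only has to satisfy finitely many consistent bounds.  The region is
   bounded iff no gap Y_(i+1) - Y_i exceeds 1, that is, iff v_i < 2 i for all i.
   The number of such v is the number C(2n, n) of ballot paths of length 2 n. *)

Local Open Scope ring_scope.

(** * Ballot sequences *)

(* The lists [:: v_n; ...; v_1] with v_n < s, v_i < 2 i, and v_i < v_(i+1)
   unless v_i = 0.  For s = 2 n the nonzero entries are the positions, counted
   from the end, of the down steps of a ballot path of length 2 n. *)
Fixpoint ballot_seqs (n s : nat) : seq (seq nat) :=
  if n is m.+1 then
    [seq t :: u | t <- iota 0 (minn s m.+1.*2), u <- ballot_seqs m (maxn t 1)]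
  else [:: [::]].

Lemma size_ballot_seqs_rec n s : size (ballot_seqs n.+1 s) =
  (\sum_(0 <= t < minn s n.+1.*2) size (ballot_seqs n (maxn t 1)))%N.
Proof.
by rewrite /= size_allpairs_dep sumnE big_map /index_iota subn0.
Qed.

Lemma size_ballot_seqs1 n : size (ballot_seqs n 1) = 1%N.
Proof.
elim: n => // n IHn; rewrite size_ballot_seqs_rec.
have -> : minn 1 n.+1.*2 = 1%N by lia.
by rewrite big_nat1.
Qed.

(** Raising the bound from s to s + 1 admits exactly the lists with head s; their tails are bounded
    by [maxn s 1], which is s. *)
Lemma size_ballot_seqsS n s : (0 < s < n.+1.*2)%N ->
  size (ballot_seqs n.+1 s.+1) =
  (size (ballot_seqs n.+1 s) + size (ballot_seqs n s))%N.
Proof.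
move=> ?; rewrite !size_ballot_seqs_rec.
have -> : minn s.+1 n.+1.*2 = s.+1 by lia.
have -> : minn s n.+1.*2 = s by lia.
by rewrite big_nat_recr //= (maxn_idPl _) //; lia.
Qed.

(** The number of binary words of length r with at most n ones and at most n zeros. *)
Definition binomial_window n r := (\sum_(r - n <= d < n.+1) 'C(r, d))%N.

Lemma binomial_windowS n r : (r <= n.*2)%N ->
  binomial_window n.+1 r.+1 = (binomial_window n.+1 r + binomial_window n r)%N.
Proof.
move=> ler; rewrite /binomial_window subSS.
case Ec: (r - n)%N => [|c].
  have -> : (r - n.+1)%N = 0%N by lia.
  rewrite big_nat_recl // (eq_bigr _ (fun d _ => binS r d)) big_split /= addnA.
  by rewrite [in RHS]big_nat_recl // !bin0.
have -> : (r - n.+1)%N = c by lia.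
have -> : (\sum_(c.+1 <= d < n.+2) 'C(r.+1, d) =
    \sum_(c.+1 <= d < n.+2) 'C(r, d) + \sum_(c <= d < n.+1) 'C(r, d))%N.
  by rewrite !big_add1 /= -big_split; apply: eq_bigr => d _; rewrite binS.
(* After Pascal's rule the two sides differ only in which of their sums contains the term d = c. *)
rewrite [in LHS](@big_ltn _ _ _ c) 1?[X in _ = (X + _)%N]big_ltn; try lia.
Qed.

Lemma binomial_window_double n : binomial_window n n.*2 = 'C(n.*2, n).
Proof. by rewrite /binomial_window -addnn addnK big_nat1. Qed.

Lemma binomial_window_double_pred n :
  binomial_window n.+1 n.*2.+1 = 'C(n.+1.*2, n.+1).
Proof.
rewrite /binomial_window; have -> : (n.*2.+1 - n.+1 = n)%N by lia.
by rewrite big_ltn ?big_nat1 ?doubleS ?binS 1?addnC; lia.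
Qed.

(** Both sides obey the same recurrence in n and s. For n > 0, at the top value s = 2 n + 1 the cap
    v_n < 2 n gives the same count as s = 2 n, and the windows at 2 n and 2 n - 1 both equal C(2 n,
    n). *)
Lemma size_ballot_seqs n s : (0 < s <= n.*2.+1)%N ->
  size (ballot_seqs n s) = binomial_window n s.-1.
Proof.
elim: n s => [|n IHn] s.
  by case: s => [|[]] // _; rewrite /binomial_window big_nat1.
elim: s => // -[_ _|s IHs les].
  rewrite size_ballot_seqs1 /binomial_window sub0n big_nat_recl // bin0 big1 //.
have [/eqP s_top|s_lt] := boolP (s == n.*2.+1).
  rewrite s_top -[(n.*2.+3).-1]doubleS binomial_window_double.
  rewrite -binomial_window_double_pred -[n.*2.+1 in RHS]/(n.*2.+2.-1) -s_top -IHs; last by lia.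
  rewrite !size_ballot_seqs_rec.
  by have -> : minn s.+2 n.+1.*2 = minn s.+1 n.+1.*2 by lia.
rewrite size_ballot_seqsS ?IHs ?IHn; [|lia..].
by rewrite /= binomial_windowS //; lia.
Qed.

Lemma size_ballot_seqs_double n : (0 < n)%N ->
  size (ballot_seqs n n.*2) = 'C(2 * n, n).
Proof.
case: n => // n _; rewrite size_ballot_seqs; last by lia.
by rewrite mul2n -binomial_window_double_pred.
Qed.

Lemma uniq_ballot_seqs n s : uniq (ballot_seqs n s).
Proof.
elim: n s => //= n IHn s; apply: allpairs_uniq_dep => //; first exact: iota_uniq.
by move=> [t u] [t' u'] _ _ /= [-> ->].
Qed.

Lemma mem_ballot_seqs n s t u : (t :: u \in ballot_seqs n.+1 s) =
  [&& (t < s)%N, (t < n.+1.*2)%N & u \in ballot_seqs n (maxn t 1)].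
Proof.
apply/allpairsPdep/and3P => [[t' [u' []]]|[lt_ts lt_tn uP]].
  by rewrite mem_iota => ? + [-> ->]; split=> //; lia.
by exists t, u; split=> //; rewrite mem_iota; lia.
Qed.

Lemma mem_ballot_seqs0 n s : [::] \in ballot_seqs n.+1 s = false.
Proof. by apply/negP => /allpairsPdep[? [? []]]. Qed.

Lemma size_mem_ballot_seqs n s u : u \in ballot_seqs n s -> size u = n.
Proof.
elim: n s u => [|n IHn] s [|t u] //; first by rewrite mem_ballot_seqs0.
by rewrite mem_ballot_seqs => /and3P[_ _ /IHn /= ->].
Qed.

(* The entry v_i; the junk value at i = 0 is 0, as [realizes] needs. *)
Definition level (u : seq nat) (i : nat) := nth 0%N u (size u - i).

Lemma level_cons t u i : (i <= size u)%N -> level (t :: u) i = level u i.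
Proof. by move=> lei; rewrite /level /= subSn. Qed.

Lemma level_size t u : level (t :: u) (size u).+1 = t.
Proof. by rewrite /level subnn. Qed.

Lemma level0 u : level u 0 = 0%N.
Proof. by rewrite /level subn0 nth_default. Qed.

(** * Realizations by increasing sequences *)

(* [level u i] counts the indices l in [-i, i] with p_l + 1 < Y i, where
   p_j = Y j and p_(-j) = - Y j for j >= 0. *)
Definition realizes (R : realDomainType) (n : nat) (v : nat -> nat) (Y : nat -> R) :=
  [/\ Y 0%N = 0,
      forall i j, (i < j <= n)%N -> Y i < Y j,
      forall i j, (j < i <= n)%N -> Num.sg (Y i - Y j - 1) = (-1) ^+ (v i <= i + j)%N
    & forall i j, (j <= i <= n)%N -> Num.sg (Y i + Y j - 1) = (-1) ^+ (v i <= i - j)%N].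

(** The clauses of [realizes] fix the signs for j <= i; the remaining ones follow by symmetry, or
    because Y j - Y i - 1 is negative when j <= i. *)
Lemma realizes_sg (R : realDomainType) n v (Y Y' : nat -> R) :
  realizes n v Y -> realizes n v Y' -> forall i j, (i <= n)%N -> (j <= n)%N ->
  [/\ Num.sg (Y i - Y j) = Num.sg (Y' i - Y' j),
      Num.sg (Y i - Y j - 1) = Num.sg (Y' i - Y' j - 1)
    & Num.sg (Y i + Y j - 1) = Num.sg (Y' i + Y' j - 1)].
Proof.
move=> [Y0 Ylt Ysub Yadd] [Y'0 Y'lt Y'sub Y'add].
suff le i j : (j <= i <= n)%N ->
  [/\ Num.sg (Y i - Y j) = Num.sg (Y' i - Y' j),
      Num.sg (Y i - Y j - 1) = Num.sg (Y' i - Y' j - 1),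
      Num.sg (Y j - Y i - 1) = Num.sg (Y' j - Y' i - 1)
    & Num.sg (Y i + Y j - 1) = Num.sg (Y' i + Y' j - 1)].
  move=> i j lei lej; have [leij|/ltnW leji] := leqP i j.
    have [|H1 H2 H3 H4] := le j i; first lia.
    split; [|exact: H3|by rewrite [Y i + _]addrC H4 [Y' j + _]addrC].
    by rewrite -opprB -[in RHS]opprB !sgrN H1.
  by have [|H1 H2 H3 H4] := le i j; first lia.
move=> /[dup] ji; rewrite leq_eqVlt => /andP[/orP[/eqP->|lt_ji] le_in].
  by rewrite !subrr !sub0r; split=> //; rewrite Yadd ?Y'add // leqnn.
have := Ylt j i; have := Y'lt j i; rewrite lt_ji le_in => /(_ isT) ? /(_ isT) ?.
split; first by rewrite !gtr0_sg; lra.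
- by rewrite Ysub ?Y'sub ?lt_ji.
- by rewrite !ltr0_sg; lra.
- by rewrite Yadd ?Y'add.
Qed.

Lemma level_lt n s u : (0 < s)%N -> u \in ballot_seqs n s -> (level u n < s)%N.
Proof.
case: n u => [|n] [|t u] // s0.
rewrite mem_ballot_seqs => /and3P[lt_ts _ /size_mem_ballot_seqs su].
by rewrite -su level_size.
Qed.

(** The bound s constrains the head of the list only. *)
Lemma mem_ballot_seqsW n s s' u :
  u \in ballot_seqs n s -> (level u n < s')%N -> u \in ballot_seqs n s'.
Proof.
case: n u => [|n] [|t u] //; first by rewrite mem_ballot_seqs0.
rewrite !mem_ballot_seqs => /and3P[_ -> uP].
by rewrite -(size_mem_ballot_seqs uP) level_size (size_mem_ballot_seqs uP) uP => ->.
Qed.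

(** The midpoint of the largest lower bound and the smallest upper bound works; l0 and u0 ensure
    that both exist. *)
Lemma exists_between (R : realFieldType) (l0 u0 : R) (L U : seq R) :
  {in l0 :: L & u0 :: U, forall l u, l < u} ->
  exists y, {in l0 :: L, forall l, l < y} /\ {in u0 :: U, forall u, y < u}.
Proof.
move=> lt_LU; pose M := \big[Order.max/l0]_(l <- L) l.
pose m := \big[Order.min/u0]_(u <- U) u.
have leM l : l \in l0 :: L -> l <= M.
  rewrite inE => /predU1P[->|lL]; first exact: bigmax_ge_id.
  exact: (le_bigmax_seq _ l).
have gem u : u \in u0 :: U -> m <= u.
  rewrite inE => /predU1P[->|uU]; first exact: bigmin_le_id.
  exact: (ge_bigmin_seq _ u).
have lt_Mm : M < m.
  have lt_l l : l \in l0 :: L -> l < m.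
    move=> lL; rewrite /m big_seq; apply: lt_bigmin => [|u uU];
      by apply: lt_LU; rewrite // inE ?eqxx ?uU ?orbT.
  rewrite /M big_seq; apply: bigmax_lt => [|l lL];
    by apply: lt_l; rewrite inE ?eqxx ?lL ?orbT.
exists ((M + m) / 2); split=> [l /leM|u /gem]; lra.
Qed.

Lemma realizes_sub n (R : realDomainType) v (Y : nat -> R) i j :
  realizes n v Y -> (j <= i <= n)%N -> (v i <= i + j)%N -> Y i < Y j + 1.
Proof.
case=> _ _ Ysub _ /andP[]; rewrite leq_eqVlt => /orP[/eqP->|ji] le_in v_le; first lra.
by have := Ysub i j; rewrite ji le_in v_le => /(_ isT) /eqP; rewrite expr1 sgr_cp0; lra.
Qed.

Lemma realizes_ge0 n (R : realDomainType) v (Y : nat -> R) i :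
  realizes n v Y -> (i <= n)%N -> 0 <= Y i.
Proof.
case=> Y0 Ylt _ _; case: i => [|i] le_in; first by rewrite Y0.
by rewrite -Y0 ltW ?Ylt.
Qed.

Lemma realizes0 (R : realDomainType) (Y : nat -> R) :
  Y 0%N = 0 -> realizes 0 (level [::]) Y.
Proof.
move=> Y0; split=> // i j ij; try lia.
have [-> ->] : i = 0%N /\ j = 0%N by lia.
by rewrite Y0 addr0 sub0r sgrN sgr1.
Qed.

(** The induction step for building realizations: y becomes the new largest value, with level t. *)
Lemma realizesS n (R : realDomainType) t u (Y : nat -> R) y : size u = n ->
  realizes n (level u) Y -> Y n < y ->
  (forall j, (j <= n)%N -> Num.sg (y - Y j - 1) = (-1) ^+ (t <= n.+1 + j)%N) ->
  (forall j, (j <= n)%N -> Num.sg (y + Y j - 1) = (-1) ^+ (t <= n.+1 - j)%N) ->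
  Num.sg (y + y - 1) = (-1) ^+ (t == 0)%N ->
  realizes n.+1 (level (t :: u)) (fun i => if (i <= n)%N then Y i else y).
Proof.
move=> su [Y0 Ylt Ysub Yadd] ltYy ysub yadd yy.
have levt : level (t :: u) n.+1 = t by rewrite -su level_size.
split=> // i j.
- move=> /andP[ij]; rewrite leq_eqVlt => /predU1P[ein|].
    subst j.
    rewrite ltnn -ltnS ij; have [->//|?] := eqVneq i n.
    by apply: lt_trans ltYy; apply: Ylt; lia.
  by rewrite ltnS => jn; rewrite jn (leq_trans (ltnW ij) jn); apply: Ylt; rewrite ij.
- move=> /andP[ji]; rewrite leq_eqVlt => /predU1P[ein|].
    by subst i; rewrite ltnn -ltnS ji levt ysub.
  rewrite ltnS => le_in; rewrite level_cons ?su // le_in.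
  by rewrite (leq_trans (ltnW ji) le_in) Ysub ?ji.
- move=> /andP[ji]; rewrite leq_eqVlt => /predU1P[ein|].
    subst i; rewrite ltnn levt.
    move: ji; rewrite leq_eqVlt => /predU1P[->|]; first by rewrite ltnn yy subnn leqn0.
    by rewrite ltnS => jn; rewrite jn yadd.
  rewrite ltnS => le_in; rewrite level_cons ?su // le_in.
  by rewrite (leq_trans ji le_in) Yadd ?ji.
Qed.

Lemma realizable (R : realFieldType) n s u : u \in ballot_seqs n s ->
  exists Y : nat -> R, realizes n (level u) Y.
Proof.
elim: n s u => [|n IHn] s [|t u] //.
- by move=> _; exists (fun=> 0); apply: realizes0.
- by rewrite mem_ballot_seqs0.
rewrite mem_ballot_seqs => /and3P[_ lt_tn uP].
have su := size_mem_ballot_seqs uP.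
have lev : (level u n < maxn t 1)%N by apply: level_lt uP; lia.
have [Y YP] := IHn _ _ uP; have [Y0 Ylt Ysub Yadd] := YP.
have Yle i j : (i <= j <= n)%N -> Y i <= Y j.
  move=> /andP[]; rewrite leq_eqVlt => /predU1P[->//|ij jn].
  by rewrite ltW ?Ylt ?ij.
have Yge0 i : (i <= n)%N -> 0 <= Y i := realizes_ge0 YP.
(* As v_n < max(t, 1), a point not counted for y is not counted for Y n either, so the upper bounds
   on y lie above Y n. *)
have ltn j : (j <= n)%N -> (t <= n.+1 - j)%N -> Y n + Y j < 1.
  move=> jn tj; have := Yadd n j; rewrite jn leqnn => /(_ isT).
  have -> : (level u n <= n - j)%N by lia.
  by move=> /eqP; rewrite expr1 sgr_cp0; lra.
(* The symmetric points are numbered from 0: - y has index 0 and gives the bound 1 / 2, while - Y j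
   and Y j have the indices n + 1 - j and n + 1 + j. Indices below t give lower bounds on y, the
   others upper bounds. *)
pose L := [seq x <- [:: 1 / 2] | (0 < t)%N]
  ++ [seq Y j + 1 | j <- iota 0 n.+1 & (n.+1 + j < t)%N]
  ++ [seq 1 - Y j | j <- iota 0 n.+1 & (n.+1 - j < t)%N].
pose U := [seq x <- [:: 1 / 2] | (t == 0)%N]
  ++ [seq Y j + 1 | j <- iota 0 n.+1 & (t <= n.+1 + j)%N]
  ++ [seq 1 - Y j | j <- iota 0 n.+1 & (t <= n.+1 - j)%N].
have LP l : l \in Y n :: L -> [\/ l = Y n, (0 < t)%N /\ l = 1 / 2,
    exists2 j, (j <= n)%N /\ (n.+1 + j < t)%N & l = Y j + 1
  | exists2 j, (j <= n)%N /\ (n.+1 - j < t)%N & l = 1 - Y j].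
  rewrite inE !mem_cat mem_filter inE => /predU1P[->|/or3P[]]; first exact: Or41.
  - by move=> /andP[? /eqP ->]; apply: Or42.
  - by move=> /mapP[j]; rewrite mem_filter mem_iota => ? ->; apply: Or43; exists j => //; lia.
  - by move=> /mapP[j]; rewrite mem_filter mem_iota => ? ->; apply: Or44; exists j => //; lia.
have UP l : l \in Y n + 1 :: U -> [\/ t = 0%N /\ l = 1 / 2,
    exists2 j, (j <= n)%N /\ (t <= n.+1 + j)%N & l = Y j + 1
  | exists2 j, (j <= n)%N /\ (t <= n.+1 - j)%N & l = 1 - Y j].
  rewrite inE !mem_cat mem_filter inE => /predU1P[->|/or3P[]].
  - by apply: Or32; exists n => //; lia.
  - by move=> /andP[/eqP ? /eqP ->]; apply: Or31.
  - by move=> /mapP[j]; rewrite mem_filter mem_iota => ? ->; apply: Or32; exists j => //; lia.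
  - by move=> /mapP[j]; rewrite mem_filter mem_iota => ? ->; apply: Or33; exists j => //; lia.
(* The bound [Y n + 1] is always among the upper ones because t <= 2 n + 1. Bounds from two
   translated points compare as their indices do. *)
have [|y [Ly Uy]] := @exists_between _ (Y n) (Y n + 1) L U.
  move=> l l' /LP lP /UP; have Yn0 := Yge0 n (leqnn n).
  case: lP => [->|[t0 ->]|[j [jn tj] ->]|[j [jn tj] ->]];
  case=> [[t0' ->]|[k [kn tk] ->]|[k [kn tk] ->]]; try lia.
  - have := ltn n (leqnn n); rewrite t0' => /(_ isT); lra.
  - by apply: (realizes_sub YP); lia.
  - have := ltn k kn tk; lra.
  - have := Yge0 k kn; lra.
  - have := ltn k kn tk; have := Yle k n; rewrite kn leqnn => /(_ isT); lra.
  - have : Y j < Y k by apply: Ylt; lia. lra.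
  - have := Yge0 j jn; have := Yge0 k kn.
    have : (0 < j)%N || (0 < k)%N by lia.
    by case/orP => [j0|k0]; [have := Ylt 0%N j|have := Ylt 0%N k];
      rewrite Y0 ?j0 ?k0 ?jn ?kn => /(_ isT); lra.
  - have : Y k < Y j by apply: Ylt; lia. lra.
exists (fun i => if (i <= n)%N then Y i else y); apply: realizesS => //.
- by apply: Ly; rewrite inE eqxx.
- move=> j jn; have [tj|tj] := leqP t (n.+1 + j).
    suff : y < Y j + 1 by move=> ?; apply/eqP; rewrite sgr_cp0; lra.
    apply: Uy; rewrite inE !mem_cat; apply/orP; right; apply/or3P/Or32/map_f.
    by rewrite mem_filter tj mem_iota; lia.
  suff : Y j + 1 < y by move=> ?; apply/eqP; rewrite sgr_cp0; lra.
  apply: Ly; rewrite inE !mem_cat; apply/orP; right; apply/or3P/Or32/map_f.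
  by rewrite mem_filter tj mem_iota; lia.
- move=> j jn; have [tj|tj] := leqP t (n.+1 - j).
    suff : y < 1 - Y j by move=> ?; apply/eqP; rewrite sgr_cp0; lra.
    apply: Uy; rewrite inE !mem_cat; apply/orP; right; apply/or3P/Or33/map_f.
    by rewrite mem_filter tj mem_iota; lia.
  suff : 1 - Y j < y by move=> ?; apply/eqP; rewrite sgr_cp0; lra.
  apply: Ly; rewrite inE !mem_cat; apply/orP; right; apply/or3P/Or33/map_f.
  by rewrite mem_filter tj mem_iota; lia.
- case: eqVneq => t0.
    suff : y < 1 / 2 by move=> ?; apply/eqP; rewrite sgr_cp0; lra.
    by apply: Uy; rewrite inE !mem_cat mem_filter t0 inE !eqxx orbT.
  suff : 1 / 2 < y by move=> ?; apply/eqP; rewrite sgr_cp0; lra.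
  by apply: Ly; rewrite inE !mem_cat mem_filter lt0n t0 inE !eqxx orbT.
Qed.

(** Converse of [realizable]: the new entry is the first index whose translated point is not below
    the new value, and the gap bound keeps it under its cap. *)
Lemma realizes_exists (R : realDomainType) n (Y : nat -> R) : Y 0%N = 0 ->
  (forall i j, (i < j <= n)%N -> Y i < Y j) ->
  (forall i j, (i <= n)%N -> (j <= n)%N -> Y i - Y j - 1 != 0) ->
  (forall i j, (i <= n)%N -> (j <= n)%N -> Y i + Y j - 1 != 0) ->
  (forall i, (i < n)%N -> Y i.+1 < Y i + 1) ->
  exists2 u, u \in ballot_seqs n n.*2 & realizes n (level u) Y.
Proof.
move=> Y0; elim: n => [|n IHn] Ylt nsub nadd gap.
  by exists [::] => //; apply: realizes0.
have [i j|i j iN jN|i j iN jN|i iN|u uP YP] := IHn.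
- by move=> ij; apply: Ylt; lia.
- by apply: nsub; lia.
- by apply: nadd; lia.
- by apply: gap; lia.
have su := size_mem_ballot_seqs uP.
(* The points -Y (n.+1) < ... < -Y 1 < Y 0 < Y 1 < ... in increasing order. *)
pose p m := if (m <= n.+1)%N then - Y (n.+1 - m)%N else Y (m - n.+1)%N.
pose P m := p m + 1 < Y n.+1.
have Yge0 i : (i <= n.+1)%N -> 0 <= Y i.
  by case: i => [|i] iN; rewrite ?Y0 // -Y0 ltW // Ylt.
have Yle i j : (i <= j <= n.+1)%N -> Y i <= Y j.
  move=> /andP[]; rewrite leq_eqVlt => /predU1P[->//|ij jn].
  by rewrite ltW ?Ylt ?ij.
have Pnot : exists m, (m < n.+1.*2)%N && ~~ P m.
  (* Index 2 n + 1 belongs to the point Y n. *)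
  exists n.*2.+1; apply/andP; split; first lia.
  rewrite /P /p -leNgt; have := gap n (ltnSn n); case: ifPn => h.
    have n0 : n = 0%N by lia.
    have -> : (n.+1 - n.*2.+1 = 0)%N by lia.
    rewrite [X in Y X + 1]n0 Y0; lra.
  have -> : (n.*2.+1 - n.+1 = n)%N by lia.
  lra.
case: (ex_minnP Pnot) => t /andP[t_lt nPt] tmin.
have PE m : (m < n.+1.*2)%N -> P m = (m < t)%N.
  move=> m_lt; apply/idP/idP => [Pm|mt]; last first.
    by apply/negPn/negP => nPm; have := tmin m; rewrite m_lt nPm => /(_ isT); lia.
  rewrite ltnNge; apply/negP => tm; move/negP: nPt; apply.
  apply: le_lt_trans Pm; rewrite lerD2r /p.
  case: ifPn => h1; case: ifPn => h2.
  - by rewrite lerN2 Yle //; lia.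
  - have := Yge0 (n.+1 - t)%N ltac:(lia).
    by have := Yge0 (m - n.+1)%N ltac:(lia); lra.
  - lia.
  - by rewrite Yle //; lia.
have subE j : (j <= n)%N -> (Y j + 1 < Y n.+1) = (n.+1 + j < t)%N.
  move=> jn; rewrite -PE; last by lia.
  rewrite /P /p; case: ifPn => h; last by rewrite addKn.
  have -> : j = 0%N by lia.
  by rewrite addn0 subnn Y0 oppr0.
have addE j : (j <= n.+1)%N -> (1 - Y j < Y n.+1) = (n.+1 - j < t)%N.
  move=> jn; rewrite -PE; last by lia.
  by rewrite /P /p leq_subr subKn // addrC.
(* If v_n = w + 1, the point of index w at step n has its translate below Y n, hence below Y (n +
   1). Its index at step n + 1 is w + 1, because - Y (n + 1) now comes first; so w + 1 < t. *)
have lev : (level u n < maxn t 1)%N.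
  rewrite leq_max; case Ew: (level u n) => [|w]; first by rewrite orbT.
  apply/orP; left; have [_ _ Ysub Yadd] := YP.
  have wn : (w < n.*2)%N.
    move: Ew (@level_lt n n.*2 u); case: (n) uP => [|m] uP Ew; first by rewrite level0 in Ew.
    by move=> /(_ _ uP); rewrite Ew; lia.
  have Ynn := Ylt n n.+1; rewrite ltnS leqnn in Ynn; move: (Ynn isT) => {}Ynn.
  have [nw|wn'] := leqP n w.
    have := Ysub n (w - n)%N; rewrite Ew => /(_ ltac:(lia)).
    have -> : (w < n + (w - n))%N = false by lia.
    move=> /eqP; rewrite expr0 sgr_cp0 => ?.
    have := subE (w - n)%N ltac:(lia).
    have -> : (n.+1 + (w - n) = w.+1)%N by lia.
    by move=> <-; lra.
  have := Yadd n (n - w)%N; rewrite Ew => /(_ ltac:(lia)).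
  have -> : (w < n - (n - w))%N = false by lia.
  move=> /eqP; rewrite expr0 sgr_cp0 => ?.
  have := addE (n - w)%N ltac:(lia).
  have -> : (n.+1 - (n - w) = w.+1)%N by lia.
  by move=> <-; lra.
exists (t :: u).
  by rewrite mem_ballot_seqs t_lt (mem_ballot_seqsW uP lev).
have sgE (x : R) b : x != 0 -> (0 < x) = b -> Num.sg x = (-1) ^+ (~~ b).
  by move=> x0 <-; case: (sgrP x) x0; rewrite ?eqxx // ?expr0 ?expr1.
suff : realizes n.+1 (level (t :: u)) (fun i => if (i <= n)%N then Y i else Y n.+1).
  move=> [H0 H1 H2 H3].
  have YE i : (i <= n.+1)%N -> Y i = if (i <= n)%N then Y i else Y n.+1.
    by move=> iN; case: leqP => // ni; congr Y; lia.
  split=> // i j ij.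
  - by rewrite (YE i) 1?(YE j); [exact: H2|lia..].
  - by rewrite (YE i) 1?(YE j); [exact: H3|lia..].
apply: realizesS => //.
- by apply: Ylt; lia.
- move=> j jn; rewrite (sgE _ (n.+1 + j < t)%N) -?leqNgt //; first by apply: nsub; lia.
  by rewrite -subE //; apply/idP/idP => ?; lra.
- move=> j jn; rewrite (sgE _ (n.+1 - j < t)%N) -?leqNgt //; first by apply: nadd; lia.
  by rewrite -addE; [apply/idP/idP => ?; lra|lia].
- rewrite (sgE _ (0 < t)%N) -?eqn0Ngt //; first exact: nadd.
  by rewrite -[0%N in RHS](subnn n.+1) -addE //; apply/idP/idP => ?; lra.
Qed.

(** * Ranks and sorting permutations *)

Definition rank_of n (w : 'S_n) (k : option 'I_n) : nat := oapp (fun i => (w i).+1) 0%N k.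

Lemma rank_of_le n (w : 'S_n) k : (rank_of w k <= n)%N.
Proof. by case: k => [i|] //=; exact: ltn_ord. Qed.

Lemma rank_of_inj n (w : 'S_n) : injective (rank_of w).
Proof. by case=> [i|] [j|] //= [/val_inj/perm_inj ->]. Qed.

Lemma rank_of_surj n (w : 'S_n) m : (m <= n)%N -> exists k, rank_of w k = m.
Proof.
case: m => [_|m mn]; first by exists None.
by exists (Some ((w^-1)%g (Ordinal mn))); rewrite /= permKV.
Qed.

(** The permutation sends i to the number of values smaller than a i. *)
Lemma sorting_perm (R : realDomainType) n (a : 'I_n -> R) : injective a ->
  exists w : 'S_n, forall i j, (w i < w j)%N = (a i < a j).
Proof.
move=> a_inj; pose r i := #|[pred j | a j < a i]|.
have r_lt i : (r i < n)%N.
  rewrite -[n in (_ < n)%N]card_ord; apply: proper_card; apply/properP.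
  by split; [exact/fintype.subsetP|exists i; rewrite ?inE // ltxx].
have rE i j : (r i < r j)%N = (a i < a j).
  apply/idP/idP => [|ij].
    apply: contraTT; rewrite -leNgt -leqNgt => ji; apply/subset_leq_card/fintype.subsetP => k.
    by rewrite !inE => /lt_le_trans; apply.
  apply: proper_card; apply/properP; split.
    by apply/fintype.subsetP => k; rewrite !inE => /lt_trans; apply.
  by exists i; rewrite !inE ?ltxx.
have r_inj : injective (fun i => Ordinal (r_lt i)).
  move=> i j [] rij; apply: a_inj; apply/eqP; rewrite eq_le !leNgt -!rE.
  by rewrite rij ltnn.
by exists (perm r_inj) => i j; rewrite !permE /= rE.
Qed.

(** The value w i is the number of j with w j < w i, so the comparisons determine w. *)
Lemma perm_lt_inj n (w w' : 'S_n) :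
  (forall i j, (w i < w j)%N = (w' i < w' j)%N) -> w = w'.
Proof.
have E (s : 'S_n) i : nat_of_ord (s i) = #|[pred j | (s j < s i)%N]|.
  rewrite -sum1_card (eq_bigl (fun j => s j < s i)%N) //.
  have <- : (\sum_(j < n | j < s i) 1 = \sum_(j < n | s j < s i) 1)%N.
    by rewrite (reindex_inj (@perm_inj _ s)).
  by rewrite (big_ord_narrow (ltnW (ltn_ord (s i)))) sum1_card card_ord.
move=> H; apply/permP => i; apply: val_inj; rewrite /= (E w i) (E w' i).
by apply: eq_card => j; rewrite !inE H.
Qed.

Lemma sorted_values (R : realDomainType) n (a : 'I_n -> R) :
  (forall i, 0 < a i) -> injective a ->
  exists (w : 'S_n) (Y : nat -> R), [/\ Y 0%N = 0,
    forall i j, (i < j <= n)%N -> Y i < Y j & forall i, a i = Y (w i).+1].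
Proof.
move=> a0 /sorting_perm[w wE]; exists w.
pose Y m := if m is k.+1 then oapp (fun j => a ((w^-1)%g j)) 0 (insub k : option 'I_n) else 0.
have YE i : Y (w i).+1 = a i by rewrite /Y /= valK /= permK.
exists Y; split=> // -[|i] [|j] // /andP[ij jn].
  by rewrite /Y (insubT (fun k => k < n)%N jn) /=; exact: a0.
rewrite ltnS in ij; have i_lt := ltn_trans ij jn.
have := YE ((w^-1)%g (Ordinal i_lt)); have := YE ((w^-1)%g (Ordinal jn)).
by rewrite !permKV /= => -> ->; rewrite -wE !permKV.
Qed.

Local Open Scope classical_set_scope.
Local Open Scope ring_scope.

(** * Regions as sign cells *)

Definition hyp_eval (R : realType) (n : nat) (h : 'rV[R]_n * R) (x : 'rV[R]_n) :=
  \sum_(i < n) h.1 0 i * x 0 i - h.2.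

Lemma arr_complementP (R : realType) n (A : arrangement R n) x :
  arr_complement A x <-> forall h, h \in A -> hyp_eval h x != 0.
Proof.
split=> [Ax h hA|Ax [h /= hA hx]]; last first.
  have /eqP := Ax h hA; rewrite /hyp_eval; move: hx.
  by rewrite /hyperplane /= => ->; rewrite subrr.
by apply/eqP => /subr0_eq hx; apply: Ax; exists h.
Qed.

Lemma hyp_eval_continuous (R : realType) n (h : 'rV[R]_n * R) :
  continuous (hyp_eval h).
Proof.
rewrite /hyp_eval => x; apply: (@continuousB _ _ _ _ (fun=> h.2)); last exact: cst_continuous.
apply: (@continuous_big _ _ _ _ _ (@add_continuous _)) => i _ {}x.
by apply: continuousM; [exact: cst_continuous|exact: coord_continuous].
Qed.

Lemma hyp_eval_conv (R : realType) n (h : 'rV[R]_n * R) x y t :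
  hyp_eval h (x + t *: (y - x)) = (1 - t) * hyp_eval h x + t * hyp_eval h y.
Proof.
rewrite /hyp_eval; under eq_bigr do rewrite !mxE mulrDr mulrCA mulrBr.
rewrite big_split /= -mulr_sumr sumrB; lra.
Qed.

(** On a connected set that avoids a hyperplane, its affine form has a connected image without 0,
    hence a constant sign. Conversely, the segment between two points with equal signs meets no
    hyperplane. *)
Lemma connected_component_sg (R : realType) n (A : arrangement R n) x :
  arr_complement A x ->
  connected_component (arr_complement A) x =
  [set y | forall h, h \in A -> Num.sg (hyp_eval h y) = Num.sg (hyp_eval h x)].
Proof.
move=> Ax; apply/seteqP; split=> y /=.
  move=> [C [Cx CA Cconn] Cy] h hA.
  have /connected_intervalP itvC : connected (hyp_eval h @` C).
    apply: connected_continuous_connected => //.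
    by apply: continuous_subspaceT => z; exact: hyp_eval_continuous.
  have nz z : C z -> hyp_eval h z != 0 by move=> /CA/arr_complementP; apply.
  have no0 : ~ (hyp_eval h @` C) 0 by move=> [z /nz/eqP].
  have := nz _ Cx; have := nz _ Cy.
  case: (sgrP (hyp_eval h y)) => // hy _; case: (sgrP (hyp_eval h x)) => // hx _.
    by case: no0; apply: (itvC (hyp_eval h x) (hyp_eval h y));
      [exists x|exists y|rewrite !ltW].
  by case: no0; apply: (itvC (hyp_eval h y) (hyp_eval h x));
    [exists y|exists x|rewrite !ltW].
move=> sgy.
pose g (t : R) : 'rV[R]_n := x + t *: (y - x).
exists (g @` `[0, 1]); last first.
  by exists 1; rewrite /= ?in_itv /= ?lexx ?ler01 // /g scale1r addrC subrK.
split.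
- by exists 0; rewrite /= ?in_itv /= ?lexx ?ler01 // /g scale0r addr0.
- move=> _ [t + <-] => /=; rewrite in_itv /= => /andP[t0 t1].
  apply/arr_complementP => h hA; rewrite hyp_eval_conv.
  have := sgy h hA; have /arr_complementP/(_ h hA) := Ax.
  case: (sgrP (hyp_eval h x)) => // hx _.
    by move/eqP; rewrite sgr_cp0 => hy; apply: lt0r_neq0; nra.
  by move/eqP; rewrite sgr_cp0 => hy; apply: ltr0_neq0; nra.
- apply: connected_continuous_connected; first exact: segment_connected.
  apply: continuous_subspaceT => t; apply: cvgD; first exact: cvg_cst.
  apply: cvgZl; exact: cvg_id.
Qed.

(** * The hyperplanes of BC in signed coordinates *)

Lemma sum_evec (R : realType) n (i : 'I_n) (x : 'rV[R]_n) :
  \sum_(k < n) evec R i 0 k * x 0 k = x 0 i.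
Proof.
rewrite (bigD1 i) //= big1 => [|k ki]; first by rewrite mxE !eqxx mul1r addr0.
by rewrite mxE (negbTE ki) andbF mul0r.
Qed.

Lemma hyp_eval_evec (R : realType) n (i : 'I_n) c (x : 'rV[R]_n) :
  hyp_eval (evec R i, c) x = x 0 i - c.
Proof. by rewrite /hyp_eval sum_evec. Qed.

Lemma hyp_eval_evecD (R : realType) n (i j : 'I_n) c (x : 'rV[R]_n) :
  hyp_eval (evec R i + evec R j, c) x = x 0 i + x 0 j - c.
Proof.
rewrite /hyp_eval -(sum_evec i) -(sum_evec j) -big_split.
by congr (_ - _); apply: eq_bigr => k _; rewrite /= mxE mulrDl.
Qed.

Lemma hyp_eval_evecB (R : realType) n (i j : 'I_n) c (x : 'rV[R]_n) :
  hyp_eval (evec R i - evec R j, c) x = x 0 i - x 0 j - c.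
Proof.
rewrite /hyp_eval -(sum_evec i) -(sum_evec j) -sumrB.
by congr (_ - _); apply: eq_bigr => k _; rewrite /= !mxE mulrBl.
Qed.

Lemma forall_BC (R : realType) n (P : 'rV[R]_n * R -> Prop) :
  (forall h, h \in BC R n -> P h) <->
  [/\ forall i c, c \in [:: - (3 / 2); - 1; - (1 / 2); 0; 1 / 2] -> P (evec R i, c),
      forall (i j : 'I_n) c, (i < j)%N -> c \in [:: - 2; - 1; 0] ->
        P (evec R i + evec R j, c)
    & forall (i j : 'I_n) c, (i < j)%N -> c \in [:: - 1; 0; 1] ->
        P (evec R i - evec R j, c)].
Proof.
split=> [PBC|[P1 P2 P3] h].
  split=> [i c ic|i j c ij cc|i j c ij cc]; apply: PBC; rewrite !mem_cat.
  - by apply/or3P/Or31/allpairsP; exists (i, c); rewrite /= mem_enum.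
  - by apply/or3P/Or32/allpairsP; exists ((i, j), c); rewrite /= mem_filter mem_enum ij.
  - by apply/or3P/Or33/allpairsP; exists ((i, j), c); rewrite /= mem_filter mem_enum ij.
rewrite !mem_cat => /or3P[] /allpairsP[[i c] /=].
- by move=> [_ cc ->]; apply: P1.
- by rewrite mem_filter => -[/andP[ij _] cc ->]; apply: P2.
- by rewrite mem_filter => -[/andP[ij _] cc ->]; apply: P3.
Qed.

(** [None] carries the value Y_0 = 0, of rank 0 in [rank_of], so comparing a single a i with 0 or 1
    becomes a case of comparing pairs. *)
Definition ext0 (R : realType) n (a : 'I_n -> R) (k : option 'I_n) := oapp a 0 k.

(** Undoes the shift X_i = x_i + 1/2: e gives the signs of the X_i and a, when positive, their
    absolute values. *)
Definition signed_point (R : realType) n (e : 'I_n -> bool) (a : 'I_n -> R) : 'rV[R]_n :=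
  \row_i ((-1) ^+ e i * a i - 1 / 2).

(* Every hyperplane of BC is, up to sign and scale, a comparison of two of the
   numbers 0, +- a i with offset 0 or 1, or else keeps a constant sign.  It is
   used both for [Q u v] := equality of signs and for [Q u v] := (u != 0). *)
Lemma forall_BC_signed_point (R : realType) n (Q : R -> R -> Prop) e (a b : 'I_n -> R) :
  (forall u v, Q u v -> Q (- u) (- v)) -> (forall u v, Q (u *+ 2) (v *+ 2) <-> Q u v) ->
  (forall u v, 0 < u -> 0 < v -> Q u v) ->
  (forall i, 0 < a i) -> (forall i, 0 < b i) ->
  (forall h, h \in BC R n ->
     Q (hyp_eval h (signed_point e a)) (hyp_eval h (signed_point e b))) <->
  [/\ forall k l, k != l -> Q (ext0 a k - ext0 a l) (ext0 b k - ext0 b l),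
      forall k l, Q (ext0 a k - ext0 a l - 1) (ext0 b k - ext0 b l - 1)
    & forall k l, Q (ext0 a k + ext0 a l - 1) (ext0 b k + ext0 b l - 1)].
Proof.
move=> QN Q2 Qpos a0 b0.
have Qneg u v : u < 0 -> v < 0 -> Q u v.
  by move=> u0 v0; rewrite -(opprK u) -(opprK v); apply/QN/Qpos; rewrite oppr_gt0.
have Qe u v u' v' : Q u v -> u = u' -> v = v' -> Q u' v' by move=> + <- <-.
have QNe u v u' v' : Q u v -> - u = u' -> - v = v' -> Q u' v' by move=> /QN + <- <-.
pose X (c : 'I_n -> R) i := (-1) ^+ e i * c i.
have XE c i : signed_point e c 0 i = X c i - 1 / 2 by rewrite mxE.
have Xcase i : [/\ X a i = a i & X b i = b i] \/ [/\ X a i = - a i & X b i = - b i].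
  by rewrite /X; case: (e i); [right|left]; rewrite ?expr0 ?expr1 ?mulN1r ?mul1r.
clearbody X; rewrite forall_BC; split=> [[H1 H2 H3]|[T1 T2 T3]].
(* The shift turns x_i = -3/2, 1/2 into X_i = -1, 1, then x_i = -1, 0 into 2 X_i = -1, 1 ([G1h]),
   and x_i + x_j = c - 1 into X_i + X_j = c ([G2]). Differences are unchanged ([G3]). *)
- have G1 i c : c \in [:: -1; 1] -> Q (X a i - c) (X b i - c).
    move=> cc; apply: (Qe _ _ _ _ (H1 i (c - 1 / 2) _)); last 2 first.
    + by rewrite hyp_eval_evec XE; lra.
    + by rewrite hyp_eval_evec XE; lra.
    + move: cc; rewrite !inE => /orP[/eqP->|/eqP->]; apply/or4P.
        by apply: Or41; apply/eqP; lra.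
      by apply: Or44; apply/orP; right; apply/eqP; lra.
  have G1h i c : c \in [:: -1; 1] -> Q (X a i *+ 2 - c) (X b i *+ 2 - c).
    move=> cc; have : Q (X a i - c / 2) (X b i - c / 2).
      apply: (Qe _ _ _ _ (H1 i (c / 2 - 1 / 2) _)); last 2 first.
      + by rewrite hyp_eval_evec XE; lra.
      + by rewrite hyp_eval_evec XE; lra.
      + move: cc; rewrite !inE => /orP[/eqP->|/eqP->]; apply/or4P.
          by apply: Or42; apply/eqP; lra.
        by apply: Or44; apply/orP; left; apply/eqP; lra.
    by move=> /Q2 H; apply: (Qe _ _ _ _ H); rewrite mulrnBl; lra.
  have G2 i j c : i != j -> c \in [:: -1; 0; 1] -> Q (X a i + X a j - c) (X b i + X b j - c).
    move=> ij cc; wlog lt_ij : i j ij / (i < j)%N.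
      move=> H; case: (ltngtP i j) => [|ji|/val_inj ij']; first exact: H.
        by rewrite ![X _ i + _]addrC; apply: H; rewrite // eq_sym.
      by rewrite ij' eqxx in ij.
    apply: (Qe _ _ _ _ (H2 i j (c - 1) lt_ij _)); last 2 first.
    + by rewrite hyp_eval_evecD !XE; lra.
    + by rewrite hyp_eval_evecD !XE; lra.
    + by move: cc; rewrite !inE => /or3P[/eqP->|/eqP->|/eqP->]; apply/or3P;
        [apply: Or31|apply: Or32|apply: Or33]; apply/eqP; lra.
  have G3 i j c : i != j -> c \in [:: -1; 0; 1] -> Q (X a i - X a j - c) (X b i - X b j - c).
    move=> ij cc; case: (ltngtP i j) => [lt_ij|ji|/val_inj ij'].
    + by apply: (Qe _ _ _ _ (H3 i j c lt_ij cc)); rewrite hyp_eval_evecB !XE; lra.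
    + apply: (QNe _ _ _ _ (H3 j i (- c) ji _)); last 2 first.
      * by rewrite hyp_eval_evecB !XE; lra.
      * by rewrite hyp_eval_evecB !XE; lra.
      * by move: cc; rewrite !inE => /or3P[]/eqP->; rewrite ?opprK ?oppr0 eqxx ?orbT.
    + by rewrite ij' eqxx in ij.
  have [m1 m0 p1] : [/\ -1 \in [:: -1; 0; 1 : R], 0 \in [:: -1; 0; 1 : R]
      & 1 \in [:: -1; 0; 1 : R]].
    by rewrite !inE !eqxx !orbT.
  have [m1' p1'] : -1 \in [:: -1; 1 : R] /\ 1 \in [:: -1; 1 : R] by rewrite !inE !eqxx !orbT.
  (* The signs of X_i and X_j decide which form in X_i + X_j or X_i - X_j is the comparison wanted;
     [QNe] serves where it is the opposite of that form. *)
  have pair i j : i != j -> [/\ Q (a i - a j) (b i - b j),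
      Q (a i - a j - 1) (b i - b j - 1) & Q (a i + a j - 1) (b i + b j - 1)].
    move=> ij; case: (Xcase i) => -[Ai Bi]; case: (Xcase j) => -[Aj Bj]; split;
      [ apply: (Qe _ _ _ _ (G3 i j 0 ij m0)) | apply: (Qe _ _ _ _ (G3 i j 1 ij p1))
      | apply: (Qe _ _ _ _ (G2 i j 1 ij p1)) | apply: (Qe _ _ _ _ (G2 i j 0 ij m0))
      | apply: (Qe _ _ _ _ (G2 i j 1 ij p1)) | apply: (Qe _ _ _ _ (G3 i j 1 ij p1))
      | apply: (QNe _ _ _ _ (G2 i j 0 ij m0)) | apply: (QNe _ _ _ _ (G2 i j (-1) ij m1))
      | apply: (QNe _ _ _ _ (G3 i j (-1) ij m1)) | apply: (QNe _ _ _ _ (G3 i j 0 ij m0))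
      | apply: (QNe _ _ _ _ (G3 i j (-1) ij m1)) | apply: (QNe _ _ _ _ (G2 i j (-1) ij m1)) ];
      lra.
  have single i : Q (a i - 1) (b i - 1) /\ Q (a i + a i - 1) (b i + b i - 1).
    case: (Xcase i) => -[Ai Bi]; split;
      [ apply: (Qe _ _ _ _ (G1 i 1 p1')) | apply: (Qe _ _ _ _ (G1h i 1 p1'))
      | apply: (QNe _ _ _ _ (G1 i (-1) m1')) | apply: (QNe _ _ _ _ (G1h i (-1) m1')) ]; lra.
  split.
  + case=> [i|] [j|] //= ij.
    * by case: (pair i j).
    * by apply: Qpos; rewrite subr0.
    * by apply: Qneg; rewrite sub0r oppr_lt0.
  + case=> [i|] [j|] /=.
    * have [->|ij] := eqVneq i j; last by case: (pair i j).
      by apply: Qneg; lra.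
    * by case: (single i); rewrite !subr0.
    * by apply: Qneg; [have := a0 j|have := b0 j]; lra.
    * by apply: Qneg; lra.
  + case=> [i|] [j|] /=.
    * have [->|ij] := eqVneq i j; last by case: (pair i j).
      by case: (single j).
    * by case: (single i); rewrite !addr0.
    * by case: (single j); rewrite !add0r.
    * by apply: Qneg; lra.
- have t1 i : Q (a i - 0 - 1) (b i - 0 - 1) := T2 (Some i) None.
  have t2 i j : Q (a i - a j - 1) (b i - b j - 1) := T2 (Some i) (Some j).
  have t3 i j : Q (a i + a j - 1) (b i + b j - 1) := T3 (Some i) (Some j).
  have t4 i j : i != j -> Q (a i - a j) (b i - b j) := T1 (Some i) (Some j).
  split=> [i c|i j c lt_ij|i j c lt_ij].
  + rewrite !inE !hyp_eval_evec !XE => cc.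
    have := a0 i; have := b0 i; move: cc.
    have half u v u' v' : Q u v -> u = u' *+ 2 -> v = v' *+ 2 -> Q u' v'.
      by move=> H uE vE; apply/Q2; rewrite -uE -vE.
    have halfN u v u' v' : Q u v -> - u = u' *+ 2 -> - v = v' *+ 2 -> Q u' v'.
      by move=> /QN H uE vE; apply/Q2; rewrite -uE -vE.
    (* Where the sign of X_i alone settles the side of the hyperplane, [Qpos] or [Qneg] applies; the
       halved forms come from the pair (i, i). *)
    case/or4P=> [/eqP->|/eqP->|/eqP->|/orP[/eqP->|/eqP->]] Bi Ai; case: (Xcase i) => -[-> ->];
      [ apply: Qpos | apply: (QNe _ _ _ _ (t1 i)) | apply: Qpos
      | apply: (halfN _ _ _ _ (t3 i i)) | apply: Qpos | apply: Qneg
      | apply: (half _ _ _ _ (t3 i i)) | apply: Qneg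
      | apply: (Qe _ _ _ _ (t1 i)) | apply: Qneg ]; lra.
  + rewrite !inE !hyp_eval_evecD !XE => cc.
    have ij : i != j by rewrite neq_ltn lt_ij.
    have := a0 i; have := b0 i; have := a0 j; have := b0 j; move: cc.
    case/or3P=> /eqP-> Bj Aj Bi Ai; case: (Xcase i) => -[-> ->]; case: (Xcase j) => -[-> ->];
      [ apply: Qpos | apply: (QNe _ _ _ _ (t2 j i))
      | apply: (QNe _ _ _ _ (t2 i j)) | apply: (QNe _ _ _ _ (t3 i j))
      | apply: Qpos | apply: (Qe _ _ _ _ (t4 i j ij))
      | apply: (QNe _ _ _ _ (t4 i j ij)) | apply: Qneg
      | apply: (Qe _ _ _ _ (t3 i j)) | apply: (Qe _ _ _ _ (t2 i j))
      | apply: (Qe _ _ _ _ (t2 j i)) | apply: Qneg ]; lra.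
  + rewrite !inE !hyp_eval_evecB !XE => cc.
    have ij : i != j by rewrite neq_ltn lt_ij.
    have := a0 i; have := b0 i; have := a0 j; have := b0 j; move: cc.
    case/or3P=> /eqP-> Bj Aj Bi Ai; case: (Xcase i) => -[-> ->]; case: (Xcase j) => -[-> ->];
      [ apply: (QNe _ _ _ _ (t2 j i)) | apply: Qpos
      | apply: (QNe _ _ _ _ (t3 i j)) | apply: (QNe _ _ _ _ (t2 i j))
      | apply: (Qe _ _ _ _ (t4 i j ij)) | apply: Qpos
      | apply: Qneg | apply: (QNe _ _ _ _ (t4 i j ij))
      | apply: (Qe _ _ _ _ (t2 i j)) | apply: (Qe _ _ _ _ (t3 i j))
      | apply: Qneg | apply: (Qe _ _ _ _ (t2 j i)) ]; lra.
Qed.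

(** * Bounded regions of BC *)

Lemma sg_mulrn2 (R : realDomainType) (u v : R) :
  Num.sg (u *+ 2) = Num.sg (v *+ 2) <-> Num.sg u = Num.sg v.
Proof. by rewrite -mulr_natr -(mulr_natr v) !sgrM !sgr_nat !mulr1. Qed.

Lemma sg_BC_signed_point (R : realType) n e (a b : 'I_n -> R) :
  (forall i, 0 < a i) -> (forall i, 0 < b i) ->
  (forall h, h \in BC R n ->
     Num.sg (hyp_eval h (signed_point e a)) = Num.sg (hyp_eval h (signed_point e b))) <->
  (forall k l, [/\ Num.sg (ext0 a k - ext0 a l) = Num.sg (ext0 b k - ext0 b l),
       Num.sg (ext0 a k - ext0 a l - 1) = Num.sg (ext0 b k - ext0 b l - 1)
     & Num.sg (ext0 a k + ext0 a l - 1) = Num.sg (ext0 b k + ext0 b l - 1)]).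
Proof.
move=> a0 b0.
rewrite (@forall_BC_signed_point _ _ (fun u v => Num.sg u = Num.sg v) e a b) //.
- split=> [[H1 H2 H3] k l|H]; last by split=> k l; case: (H k l).
  by split=> //; have [->|] := eqVneq k l; [rewrite !subrr|exact: H1].
- by move=> u v; rewrite !sgrN => ->.
- exact: sg_mulrn2.
- by move=> u v u0 v0; rewrite !gtr0_sg.
Qed.

Lemma complement_BC_signed_point (R : realType) n e (a : 'I_n -> R) :
  (forall i, 0 < a i) ->
  arr_complement (BC R n) (signed_point e a) <->
  [/\ forall k l, k != l -> ext0 a k - ext0 a l != 0,
      forall k l, ext0 a k - ext0 a l - 1 != 0
    & forall k l, ext0 a k + ext0 a l - 1 != 0].
Proof.
move=> a0; rewrite arr_complementP.
rewrite (@forall_BC_signed_point _ _ (fun u _ => u != 0) e a a) //.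
- by move=> u _; rewrite oppr_eq0.
- by move=> u _; rewrite mulrn_eq0.
- by move=> u _ u0 _; rewrite gt_eqF.
Qed.

Lemma signed_pointE (R : realType) n (x : 'rV[R]_n) :
  signed_point (fun i => x 0 i + 1 / 2 < 0) (fun i => `|x 0 i + 1 / 2|) = x.
Proof.
apply/rowP => i; rewrite mxE; case: ltP => h.
  by rewrite ltr0_norm // expr1; lra.
by rewrite ger0_norm // expr0; lra.
Qed.

Lemma signed_point_abs (R : realType) n (e : 'I_n -> bool) (a : 'I_n -> R) i :
  0 < a i -> `|signed_point e a 0 i + 1 / 2| = a i.
Proof. by move=> a0; rewrite mxE subrK normrM normr_sign mul1r gtr0_norm. Qed.

Lemma signed_point_lt0 (R : realType) n (e : 'I_n -> bool) (a : 'I_n -> R) i :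
  0 < a i -> (signed_point e a 0 i + 1 / 2 < 0) = e i.
Proof.
move=> a0; rewrite mxE subrK; case: (e i); rewrite ?expr0 ?expr1; last first.
  by rewrite mul1r ltNge ltW.
by rewrite mulN1r oppr_lt0.
Qed.

(** The hyperplane X_i = 0, that is x_i = -1/2, belongs to the arrangement. *)
Lemma sg_BC_coord (R : realType) n (x y : 'rV[R]_n) i :
  (forall h, h \in BC R n -> Num.sg (hyp_eval h x) = Num.sg (hyp_eval h y)) ->
  Num.sg (x 0 i + 1 / 2) = Num.sg (y 0 i + 1 / 2).
Proof.
move=> /forall_BC [H _ _]; have := H i (- (1 / 2)); rewrite !hyp_eval_evec opprK; apply.
by rewrite !inE eqxx !orbT.
Qed.

Lemma BC_coord_neq0 (R : realType) n (x : 'rV[R]_n) i :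
  arr_complement (BC R n) x -> 0 < `|x 0 i + 1 / 2|.
Proof.
move=> /arr_complementP /forall_BC [H _ _]; have := H i (- (1 / 2)).
by rewrite !hyp_eval_evec opprK normr_gt0; apply; rewrite !inE eqxx !orbT.
Qed.

(** The unit vectors are among the normals, so a region is bounded in the relative sense iff it is
    bounded as a set. *)
Lemma normal_span_BC (R : realType) n : [set` normal_span (BC R n)] = setT.
Proof.
apply/seteqP; split=> // x _ /=; rewrite [x]row_sum_delta.
apply: rpred_sum => i _; apply: rpredZ; apply: memv_span.
apply/mapP; exists (evec R i, 0) => //; rewrite !mem_cat; apply/or3P/Or31/allpairsP.
by exists (i, 0); rewrite /= mem_enum !inE eqxx !orbT.
Qed.

Lemma level_lt_double n s u i :
  u \in ballot_seqs n s -> (0 < i <= n)%N -> (level u i < i.*2)%N.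
Proof.
elim: n s u => [|n IHn] s [|t u]; try lia; first by rewrite mem_ballot_seqs0.
rewrite mem_ballot_seqs => /and3P[_ t_lt uP] /andP[i0].
have su := size_mem_ballot_seqs uP.
rewrite leq_eqVlt => /predU1P[->|]; first by rewrite -su level_size su.
by rewrite ltnS => le_in; rewrite level_cons ?su // (IHn _ _ uP) // i0.
Qed.

(** The point p_i has index 2 i + 1 at step i + 1, so it is not counted by v_(i+1) < 2 (i + 1). *)
Lemma realizes_gap (R : realDomainType) n s u (Y : nat -> R) i :
  u \in ballot_seqs n s -> realizes n (level u) Y -> (i < n)%N -> Y i.+1 < Y i + 1.
Proof.
move=> uP YP lt_in; apply: (realizes_sub YP); first by lia.
by have := @level_lt_double n s u i.+1 uP; rewrite lt_in => /(_ isT); lia.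
Qed.

Lemma realizes_neq (R : realDomainType) n v (Y : nat -> R) i j :
  realizes n v Y -> (i <= n)%N -> (j <= n)%N ->
  [/\ i != j -> Y i - Y j != 0, Y i - Y j - 1 != 0 & Y i + Y j - 1 != 0].
Proof.
move=> YP; have [_ Ylt Ysub Yadd] := YP => iN jN.
have sgn0 (x : R) b : Num.sg x = (-1) ^+ nat_of_bool b -> x != 0.
  by move=> E; rewrite -sgr_eq0 E signr_eq0.
split.
- rewrite neq_ltn subr_eq0 => /orP[ij|ji]; first by rewrite lt_eqF ?Ylt ?ij.
  by rewrite gt_eqF ?Ylt ?ji.
- have [ij|ji] := leqP i j; last by apply: sgn0; apply: Ysub; rewrite ji.
  suff : Y i <= Y j by move=> ?; apply: ltr0_neq0; lra.
  by move: ij; rewrite leq_eqVlt => /predU1P[->//|ij]; rewrite ltW ?Ylt ?ij.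
- by have [ij|/ltnW ji] := leqP i j; [rewrite [Y i + _]addrC|];
    apply: sgn0; apply: Yadd; rewrite ?ij ?ji.
Qed.

(** For m < 2 i, whether v_i <= m is read off the sign of Y i - Y (m - i) - 1 if i <= m, and of Y i
    + Y (i - m) - 1 otherwise. As v_i < 2 i, these tests determine v_i. *)
Lemma level_inj (R : realDomainType) n s u u' (Y Y' : nat -> R) :
  u \in ballot_seqs n s -> u' \in ballot_seqs n s ->
  realizes n (level u) Y -> realizes n (level u') Y' ->
  (forall i j, (i <= n)%N -> (j <= n)%N ->
    Num.sg (Y i - Y j - 1) = Num.sg (Y' i - Y' j - 1)) ->
  (forall i j, (i <= n)%N -> (j <= n)%N ->
    Num.sg (Y i + Y j - 1) = Num.sg (Y' i + Y' j - 1)) -> u = u'.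
Proof.
move=> uP u'P [_ _ Ysub Yadd] [_ _ Y'sub Y'add] Esub Eadd.
have su := size_mem_ballot_seqs uP; have su' := size_mem_ballot_seqs u'P.
have signb (b c : bool) : (-1) ^+ b = (-1) ^+ c :> R -> b = c.
  exact: signr_inj.
have lev i : (0 < i <= n)%N -> level u i = level u' i.
  move=> iN; have lt1 := level_lt_double uP iN; have lt2 := level_lt_double u'P iN.
  have cmp m : (m < i.*2)%N -> (level u i <= m)%N = (level u' i <= m)%N.
    move=> mi; have [im|mi'] := leqP i m; apply: signb.
      have := Esub i (m - i)%N; rewrite Ysub ?Y'sub; try lia.
      by rewrite subnKC // => -> //; lia.
    have := Eadd i (i - m)%N; rewrite Yadd ?Y'add; try lia.
    by rewrite subKn ?(ltnW mi') // => -> //; lia.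
  apply/eqP; rewrite eqn_leq -(cmp _ lt1) leqnn cmp ?leqnn //.
apply: (@eq_from_nth _ 0%N); first by rewrite su.
move=> k; rewrite su => kn; have := lev (n - k)%N.
by rewrite /level su su' subKn ?(ltnW kn) //; apply; lia.
Qed.

Lemma ext0_rank (R : realType) n (w : 'S_n) (Y : nat -> R) k : Y 0%N = 0 ->
  ext0 (fun i => Y (w i).+1) k = Y (rank_of w k).
Proof. by case: k. Qed.

Lemma bounded_rV (R : realType) n (A : set 'rV[R]_n) (M : R) :
  (forall x i, A x -> `|x 0 i| <= M) -> bounded_set A.
Proof.
move=> AM; exists (Num.max M 0); split=> [|N MN x Ax]; first exact: num_real.
apply: le_trans (ltW MN).
rewrite [leLHS]/Num.norm /= mx_normrE; apply: bigmax_le => [|[i j] _] /=.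
  by rewrite le_max lexx orbT.
by rewrite ord1 le_max AM.
Qed.

Lemma bounded_rV_coord (R : realType) n (A : set 'rV[R]_n) :
  bounded_set A -> exists M : R, forall x i, A x -> `|x 0 i| <= M.
Proof.
move=> [M [_ AM]]; exists (M + 1) => x i Ax.
apply: le_trans (AM (M + 1) _ x Ax); last by rewrite ltrDl.
by rewrite [leRHS]/Num.norm /= mx_normrE; apply/bigmax_geP; right => /=; exists (0, i).
Qed.

Lemma signed_point_compl (R : realType) n (w : 'S_n) e v (Y : nat -> R) :
  realizes n v Y -> arr_complement (BC R n) (signed_point e (fun i => Y (w i).+1)).
Proof.
move=> YP; have [Y0 Ylt _ _] := YP.
have pos i : 0 < Y (w i).+1 by rewrite -Y0; apply: Ylt; rewrite ltn_ord.
apply/complement_BC_signed_point => //; split=> k l; rewrite !ext0_rank //;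
  have [H1 H2 H3] := realizes_neq YP (rank_of_le w k) (rank_of_le w l) => //.
by move=> kl; apply: H1; apply: contra_neq kl => /rank_of_inj.
Qed.

(** A region fixes the signs of the X_i, so the same e describes all its points. *)
Lemma signed_point_abs_eq (R : realType) n e (a : 'I_n -> R) (x : 'rV[R]_n) :
  (forall i, 0 < a i) ->
  (forall h, h \in BC R n ->
    Num.sg (hyp_eval h x) = Num.sg (hyp_eval h (signed_point e a))) ->
  x = signed_point e (fun i => `|x 0 i + 1 / 2|) /\ forall i, 0 < `|x 0 i + 1 / 2|.
Proof.
move=> a0 sgx; have sgi i := sg_BC_coord i sgx.
have e_lt i : (x 0 i + 1 / 2 < 0) = e i.
  by rewrite -sgr_lt0 sgi sgr_lt0 signed_point_lt0.
split=> [|i]; last first.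
  by rewrite normr_gt0 -sgr_eq0 sgi sgr_eq0 -normr_gt0 signed_point_abs.
by rewrite -[LHS]signed_pointE; apply/rowP => i; rewrite !mxE e_lt.
Qed.

(** Throughout the region consecutive values differ by less than 1, so the value of rank m is at
    most m. *)
Lemma region_signed_point_bounded (R : realType) n (w : 'S_n) e s u (Y : nat -> R) :
  u \in ballot_seqs n s -> realizes n (level u) Y ->
  bounded_set (connected_component (arr_complement (BC R n))
                 (signed_point e (fun i => Y (w i).+1))).
Proof.
move=> uP YP; have [Y0 Ylt _ _] := YP.
have pos i : 0 < Y (w i).+1 by rewrite -Y0; apply: Ylt; rewrite ltn_ord.
rewrite connected_component_sg; last exact: signed_point_compl YP.
apply: (@bounded_rV _ _ _ (n%:R + 1)) => x i /= sgx.
have [xE xpos] := signed_point_abs_eq pos sgx.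
move: sgx; rewrite {1}xE => sgx.
have {}sgx := iffLR (sg_BC_signed_point e xpos pos) sgx.
set b := fun i => _ in xE xpos sgx.
have bound m k : rank_of w k = m -> ext0 b k <= m%:R.
  elim: m k => [|m IHm] k km.
    by have -> : k = None by apply: (@rank_of_inj _ w).
  have mn : (m < n)%N by rewrite -km rank_of_le.
  have [l lm] := rank_of_surj w (ltnW mn).
  have := IHm l lm; have [_ + _] := sgx k l; rewrite !ext0_rank // km lm.
  have /= gap := realizes_gap uP YP mn.
  rewrite (@ltr0_sg _ (Y m.+1 - _ - _)); last by lra.
  by move=> /eqP; rewrite sgr_cp0 -natr1; lra.
have := bound _ (Some i) erefl => /=; rewrite /b.
have : (w i).+1%:R <= n%:R :> R by rewrite ler_nat.
have := ler_normB (x 0 i + 1 / 2) (1 / 2).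
by rewrite addrK (ger0_norm (_ : 0 <= 1 / 2 :> R)); lra.
Qed.

(* Across a gap Y i + 1 < Y i.+1, pushing all the coordinates of rank above i
   away from 0 by any t >= 0 stays in the region. *)
Lemma bounded_region_gap (R : realType) n (w : 'S_n) e (Y : nat -> R) :
  Y 0%N = 0 -> (forall i j, (i < j <= n)%N -> Y i < Y j) ->
  arr_complement (BC R n) (signed_point e (fun i => Y (w i).+1)) ->
  bounded_set (connected_component (arr_complement (BC R n))
                 (signed_point e (fun i => Y (w i).+1))) ->
  forall i, (i < n)%N -> Y i.+1 < Y i + 1.
Proof.
move=> Y0 Ylt compl bnd i lt_in.
have pos j : 0 < Y (w j).+1 by rewrite -Y0; apply: Ylt; rewrite ltn_ord.
have Yle j k : (j <= k <= n)%N -> Y j <= Y k.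
  move=> /andP[]; rewrite leq_eqVlt => /predU1P[->//|jk kn].
  by rewrite ltW ?Ylt ?jk.
rewrite ltNge; apply/negP => gap.
have [ki kiE] := rank_of_surj w lt_in; have [li liE] := rank_of_surj w (ltnW lt_in).
(* Equality would put the point on a hyperplane. *)
have {}gap : Y i + 1 < Y i.+1.
  rewrite lt_neqAle gap andbT eq_sym -subr_eq0.
  have [_ H _] := iffLR (complement_BC_signed_point e pos) compl.
  by have := H ki li; rewrite !ext0_rank // kiE liE; apply: contra_neq; lra.
have Yi0 : 0 <= Y i by rewrite -Y0 Yle //; lia.
pose b (t : R) j := Y (w j).+1 + (if (i < (w j).+1)%N then t else 0).
have bpos t : 0 <= t -> forall j, 0 < b t j.
  by move=> t0 j; rewrite /b; case: ifP => _; rewrite ?addr0 // ltr_wpDr.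
have bE t k : ext0 (b t) k = Y (rank_of w k) + (if (i < rank_of w k)%N then t else 0).
  by case: k => [j|] //=; rewrite Y0 addr0.
have inC t : 0 <= t -> connected_component (arr_complement (BC R n))
    (signed_point e (fun i => Y (w i).+1)) (signed_point e (b t)).
  move=> t0; rewrite connected_component_sg //.
  apply/(sg_BC_signed_point e (bpos t t0) pos) => k l.
  rewrite !bE !ext0_rank //.
  have kn := rank_of_le w k; have ln := rank_of_le w l.
  move: (rank_of w k) (rank_of w l) kn ln => p q pn qn.
  (* If both ranks exceed i, the difference is unchanged and the sum stays above 1. If only one
     does, the difference exceeds 1 in absolute value before and after the push, and so does the
     sum. *)
  have := Yle i.+1 p; have := Yle i.+1 q; have := Yle p i; have := Yle q i.
  have := Yle 0%N p; have := Yle 0%N q; rewrite Y0 !leq0n pn qn (ltnW lt_in) !andbT.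
  move=> /(_ isT) ? /(_ isT) ?; case: (ltnP i p) => [ip|pi]; case: (ltnP i q) => [iq|qi].
  - move=> _ _ /(_ isT) ? /(_ isT) ?; split.
    + by congr Num.sg; lra.
    + by congr Num.sg; lra.
    + by rewrite !gtr0_sg //; lra.
  - move=> /(_ isT) ? _ _ /(_ isT) ?.
    by rewrite !gtr0_sg; try lra.
  - move=> _ /(_ isT) ? /(_ isT) ? _; split.
    + by rewrite !ltr0_sg //; lra.
    + by rewrite !ltr0_sg //; lra.
    + by rewrite !gtr0_sg //; lra.
  - by rewrite !addr0.
have [M HM] := bounded_rV_coord bnd.
case: ki kiE => [j|] //= [wj].
have M0 : 0 <= M + 1.
  by have := HM _ j (inC 0 (lexx 0)); have := normr_ge0 (signed_point e (b 0) 0 j); lra.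
(* The coordinate j has rank i + 1, so pushing by M + 1 makes |X_j| exceed M + 1 and hence |x_j|
   exceed M. *)
have := HM _ j (inC (M + 1) M0).
have := signed_point_abs e (bpos (M + 1) M0 j).
have := ler_normD (signed_point e (b (M + 1)) 0 j) (1 / 2).
rewrite (ger0_norm (_ : 0 <= 1 / 2 :> R)); last by lra.
move=> + E; rewrite E /b wj ltnSn; lra.
Qed.

(** Sorting the |X_i| gives w and Y; boundedness supplies the gap bounds that [realizes_exists] asks
    for. *)
Lemma bounded_region_realizes (R : realType) n (x : 'rV[R]_n) :
  arr_complement (BC R n) x ->
  bounded_set (connected_component (arr_complement (BC R n)) x) ->
  exists (w : 'S_n) (e : 'I_n -> bool) u (Y : nat -> R),
    [/\ u \in ballot_seqs n n.*2, realizes n (level u) Y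
      & x = signed_point e (fun i => Y (w i).+1)].
Proof.
move=> xC xB; pose a i := `|x 0 i + 1 / 2|.
have xE := signed_pointE x; set e := (fun i => _ < 0) in xE.
have a0 i : 0 < a i by exact: BC_coord_neq0.
have := xC; rewrite -{1}xE => /(complement_BC_signed_point e a0)[aneq asub aadd].
have a_inj : injective a.
  move=> i j aij; apply/eqP/negPn/negP => ij.
  by have := aneq (Some i) (Some j) ij; rewrite /= aij subrr eqxx.
have [w [Y [Y0 Ylt aE]]] := sorted_values a0 a_inj.
have {}xE : x = signed_point e (fun i => Y (w i).+1).
  by rewrite -[LHS]xE; apply/rowP => i; rewrite !mxE -aE.
have extE k : ext0 a k = Y (rank_of w k) by case: k => //= i; rewrite aE.
have gap : forall i, (i < n)%N -> Y i.+1 < Y i + 1.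
  by apply: (@bounded_region_gap _ _ w e Y Y0 Ylt); rewrite -xE.
have [i j iN jN|i j iN jN|u uP YP] := realizes_exists Y0 Ylt _ _ gap.
- have [k <-] := rank_of_surj w iN; have [l <-] := rank_of_surj w jN.
  by rewrite -!extE asub.
- have [k <-] := rank_of_surj w iN; have [l <-] := rank_of_surj w jN.
  by rewrite -!extE aadd.
by exists w, e, u, Y.
Qed.

(** Makes the region depend on v alone and not on the realization chosen for it. *)
Lemma signed_point_region (R : realType) n (w : 'S_n) (e : 'I_n -> bool) v (Y Y' : nat -> R) :
  realizes n v Y -> realizes n v Y' ->
  connected_component (arr_complement (BC R n)) (signed_point e (fun i => Y (w i).+1)) =
  connected_component (arr_complement (BC R n)) (signed_point e (fun i => Y' (w i).+1)).
Proof.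
move=> YP Y'P; have [Y0 Ylt _ _] := YP; have [Y'0 Y'lt _ _] := Y'P.
have pos i : 0 < Y (w i).+1 by rewrite -Y0; apply: Ylt; rewrite ltn_ord.
have pos' i : 0 < Y' (w i).+1 by rewrite -Y'0; apply: Y'lt; rewrite ltn_ord.
have sgE : forall h, h \in BC R n ->
    Num.sg (hyp_eval h (signed_point e (fun i => Y (w i).+1))) =
    Num.sg (hyp_eval h (signed_point e (fun i => Y' (w i).+1))).
  apply/sg_BC_signed_point => // k l; rewrite !ext0_rank //.
  exact: (realizes_sg YP Y'P (rank_of_le w k) (rank_of_le w l)).
rewrite !connected_component_sg; [|exact: signed_point_compl Y'P|exact: signed_point_compl YP].
by apply/seteqP; split=> y /= H h hB; rewrite H // sgE.
Qed.

(** The signs of the X_i give e, the order of the |X_i| gives w, and the comparisons with offset 1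
    give u by [level_inj]. *)
Lemma signed_point_region_inj (R : realType) n (w w' : 'S_n) (e e' : 'I_n -> bool)
    s u u' (Y Y' : nat -> R) :
  u \in ballot_seqs n s -> u' \in ballot_seqs n s ->
  realizes n (level u) Y -> realizes n (level u') Y' ->
  connected_component (arr_complement (BC R n)) (signed_point e (fun i => Y (w i).+1)) =
  connected_component (arr_complement (BC R n)) (signed_point e' (fun i => Y' (w' i).+1)) ->
  [/\ w = w', e =1 e' & u = u'].
Proof.
move=> uP u'P YP Y'P; have [Y0 Ylt _ _] := YP; have [Y'0 Y'lt _ _] := Y'P.
have pos i : 0 < Y (w i).+1 by rewrite -Y0; apply: Ylt; rewrite ltn_ord.
have pos' i : 0 < Y' (w' i).+1 by rewrite -Y'0; apply: Y'lt; rewrite ltn_ord.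
have compl := @signed_point_compl _ _ w e _ _ YP.
have compl' := @signed_point_compl _ _ w' e' _ _ Y'P.
move=> eqC; have : connected_component (arr_complement (BC R n))
    (signed_point e' (fun i => Y' (w' i).+1)) (signed_point e (fun i => Y (w i).+1)).
  by rewrite -eqC; apply: connected_component_refl.
rewrite connected_component_sg //= => sgE.
have ee' : e =1 e'.
  move=> i; rewrite -(@signed_point_lt0 _ _ e (fun i => Y (w i).+1) i (pos i)).
  rewrite -(@signed_point_lt0 _ _ e' (fun i => Y' (w' i).+1) i (pos' i)).
  by rewrite -sgr_lt0 (sg_BC_coord i sgE) sgr_lt0.
have e'E b : signed_point e' b = signed_point e b :> 'rV[R]_n.
  by apply/rowP => i; rewrite !mxE ee'.
rewrite e'E in sgE; have {}sgE := iffLR (sg_BC_signed_point e pos pos') sgE.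
have ww' : w = w'.
  apply: perm_lt_inj => i j.
  have YltE (v : nat -> nat) (Z : nat -> R) : realizes n v Z -> forall p q : 'I_n,
      (p < q)%N = (Z p.+1 - Z q.+1 < 0).
    move=> [_ Zlt _ _] p q; have pn := ltn_ord p; have qn := ltn_ord q.
    rewrite subr_lt0; have [pq|qp] := ltnP p q; first by rewrite Zlt // ltnS pq.
    apply/esym/negbTE; rewrite -leNgt; move: qp; rewrite leq_eqVlt => /predU1P[->//|qp].
    by rewrite ltW // Zlt // ltnS qp.
  rewrite (YltE _ _ YP) (YltE _ _ Y'P) -[LHS]sgr_lt0 -[RHS]sgr_lt0.
  by have [/= -> _ _] := sgE (Some i) (Some j).
subst w'; split=> //; apply: (level_inj uP u'P YP Y'P) => i j iN jN;
  have [k <-] := rank_of_surj w iN; have [l <-] := rank_of_surj w jN;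
  by have [_] := sgE k l; rewrite !ext0_rank.
Qed.

(** * Counting the bounded regions *)

Lemma card_range_inj (I : finType) (T : Type) (f : I -> T) :
  injective f -> (range f #= `I_#|I|)%card.
Proof.
move=> f_inj; rewrite (card_eqr card_II).
have -> : [set: 'I_#|I|] = range (@enum_rank I).
  by apply/seteqP; split=> // i _; exists (enum_val i); rewrite ?enum_valK.
apply: card_eq_trans (card_esym _); apply: inj_card_eq => x y _ _.
  exact: f_inj.
exact: enum_rank_inj.
Qed.

Theorem theorem5p15 (R : realType) (n : nat) (hn : (1 <= n)%N) :
  (bounded_regions (BC R n) #= `I_(2 ^ n * n`! * 'C(2 * n, n)))%card.
Proof.
pose I : finType := ('S_n * {ffun 'I_n -> bool} * seq_sub (ballot_seqs n n.*2))%type.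
(* One realization is chosen for each list; lists that are not ballot sequences get the zero
   function. *)
have [Yof YofP] : exists Yof : seq nat -> nat -> R,
    forall u, u \in ballot_seqs n n.*2 -> realizes n (level u) (Yof u).
  have /choice : forall u, exists Y : nat -> R,
      u \in ballot_seqs n n.*2 -> realizes n (level u) Y.
    move=> u; have [/(realizable R)[Y YP]|_] := boolP (u \in ballot_seqs n n.*2).
      by exists Y.
    by exists (fun=> 0).
  by move=> [Yof H]; exists Yof.
pose F (t : I) := connected_component (arr_complement (BC R n))
  (signed_point t.1.2 (fun i => Yof (ssval t.2) (t.1.1 i).+1)).
have F_inj : injective F.
  move=> [[w e] u] [[w' e'] u'] eqF.
  have [/= -> /ffunP -> uu'] := signed_point_region_inj (ssvalP u) (ssvalP u')
    (YofP _ (ssvalP u)) (YofP _ (ssvalP u')) eqF.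
  by congr (_, _); apply: val_inj.
have F_range : range F = bounded_regions (BC R n).
  apply/seteqP; split=> [_ [[[w e] u] _ <-]|C [[x xC <-]]].
    split; first by apply: imageP; apply: signed_point_compl (YofP _ (ssvalP u)).
    rewrite normal_span_BC setIT.
    exact: region_signed_point_bounded (ssvalP u) (YofP _ (ssvalP u)).
  rewrite normal_span_BC setIT => xB.
  have [w [e [u [Y [uP YP xE]]]]] := bounded_region_realizes xC xB.
  exists ((w, finfun e), SeqSub uP) => //; rewrite /F /= xE.
  (* The sequence Y read off the point x need not be the chosen one, but both realize u. *)
  rewrite (signed_point_region w e YP (YofP _ uP)); congr connected_component.
  by apply/rowP => i; rewrite !mxE ffunE.
have <- : #|I| = (2 ^ n * n`! * 'C(2 * n, n))%N.
  rewrite !card_prod card_Sn card_ffun card_bool card_ord card_seq_sub ?uniq_ballot_seqs //.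
  by rewrite size_ballot_seqs_double // (mulnC n`!).
by rewrite -F_range; exact: card_range_inj.
Qed.
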